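(* Let $D$ be a GMPD domain with $|\mathcal{O}(D)|<\infty$. Then there exists a Prüfer domain $R$ such that $\operatorname{Spec}(D)\cong \operatorname{Spec}(R)$ as partially ordered sets (ordered by inclusion).
   Context: All rings are commutative unitary integral domains. For an integral domain $D$ with quotient field $K$, an overring of $D$ is a subring of $K$ containing $D$, and $\mathcal{O}(D)$ is the set of all overrings of $D$. $\operatorname{Spec}(D)$ is the set of prime ideals of $D$, partially ordered by inclusion. Two partially ordered sets $U$ and $V$ are isomorphic if there is an order preserving bijection $f:U\to V$ such that $f^{-1}$ is also order preserving. $D$ is h-local if each nonzero ideal of $D$ is contained in only finitely many maximal ideals and each nonzero prime ideal is contained in a unique maximal ideal. An MNI ideal of $D$ is an ideal of $D$ which is maximal (under inclusion) among the non-invertible ideals of $D$ (the zero ideal counts as non-invertible). $D$ is an MPD domain if it has a unique MNI ideal $Q$ and every nonzero non-invertible ideal of $D$ can be written as $JQ$ for some invertible ideal $J$ of $D$. $D$ is a GMPD domain (globalized multiplicatively pinched-Dedekind domain) if $D$ is h-local and the localization $D_M$ is an MPD domain for every maximal ideal $M$ of $D$. *)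

(* Defs.v *)
From HB Require Import structures.
From mathcomp Require Import all_boot all_order all_algebra.
From mathcomp Require Import ring_quotient.
From mathcomp Require Import boolp classical_sets cardinality.

Set Implicit Arguments.
Unset Strict Implicit.
Unset Printing Implicit Defensive.

Import Order.TTheory GRing.Theory.

Local Open Scope classical_set_scope.
Local Open Scope ring_scope.

Definition poset_isomorphic d d' (U : porderType d) (V : porderType d') :=
  exists (f : U -> V) (g : V -> U),
    [/\ cancel f g, cancel g f,
        {homo f : x y / (x <= y)%O} & {homo g : x y / (x <= y)%O}].

(* For ideals I and J of a ring this is the product ideal IJ; it is also used
   for D-submodules of the quotient field of D. *)
Definition set_prod (T : pzRingType) (A B : set T) : set T :=
  [set x | exists n (a b : 'I_n -> T),
     [/\ forall i, A (a i), forall i, B (b i) & x = \sum_(i < n) a i * b i]].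

Section Ideals.
Context {D : idomainType}.
Implicit Types I J P Q M : set D.

Local Notation K := {fraction D}.
Local Notation "x %:F" := (@FracField.tofrac D x).

(* The unit ideal D is allowed. Beware that [idealr_closed] below, unlike
   [ideal], also asserts 1 \notin I, i.e. that the ideal is proper. *)
Definition ideal I : Prop := submod_closed ([in I] : {pred D^o}).

Definition prime_ideal P : Prop :=
  idealr_closed [in P] /\ prime_idealr_closed [in P].

Definition maximal_ideal M : Prop :=
  idealr_closed [in M] /\
  forall I, idealr_closed [in I] -> M `<=` I -> I = M.

Definition fg_ideal I : Prop :=
  exists n (s : 'I_n -> D),
    I = [set x | exists c : 'I_n -> D, x = \sum_(i < n) c i * s i].

(* The fractional ideal (D :_K I). *)
Definition inverse_ideal I : set K :=
  [set x | forall a, I a -> range (@FracField.tofrac D) (x * a%:F)].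

Definition invertible I : Prop :=
  ideal I /\
  set_prod (@FracField.tofrac D @` I) (inverse_ideal I)
    = range (@FracField.tofrac D).

Definition MNI_ideal Q : Prop :=
  [/\ ideal Q, ~ invertible Q &
      forall I, ideal I -> ~ invertible I -> Q `<=` I -> I = Q].

Lemma maximal_ideal_prime M : maximal_ideal M -> prime_ideal M.
Proof.
move=> [Mi Mmax]; split=> // u v uvM; apply: contrapT => /negP.
rewrite negb_or => /andP[uM vM]; have [M0 M1 Ml] := Mi.
pose I := [set x : D | exists2 m, m \in M & exists a, x = m + a * u].
have MI : M `<=` I.
  by move=> m Mm; exists m; [exact/mem_set | exists 0; rewrite mul0r addr0].
have uI : I u by exists 0 => //; exists 1; rewrite add0r mul1r.
have [I1|I1] := pselect (I 1); last first.
  have /(Mmax I)/(_ MI) IM : idealr_closed [in I].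
    split; first by apply/mem_set/MI/set_mem.
      by apply/negP => /set_mem.
    move=> a _ _ /set_mem[m mM [b ->]] /set_mem[m' m'M [b' ->]].
    apply/mem_set; exists (a * m + m'); first exact: Ml.
    by exists (a * b + b'); rewrite mulrDr mulrDl !mulrA addrACA.
  by move: uI; rewrite IM => /mem_set; apply/negP.
case: I1 => m mM [a e]; case/negP: vM.
have auvM : a * (u * v) + 0 \in M by exact: Ml.
by rewrite -(mul1r v) e mulrDl mulrC -mulrA -[a * _]addr0; exact: Ml.
Qed.

End Ideals.

Section Spec.
Variable D : idomainType.

Record Spec := MkSpec {
  spec_val :> set D;
  spec_valP : `[< prime_ideal spec_val >] }.

HB.instance Definition _ := [isSub for spec_val].
HB.instance Definition _ := [Choice of Spec by <:].
HB.instance Definition _ :=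
  [SubChoice_isSubPOrder of Spec by <: with set_display].

Lemma spec_prime (P : Spec) : prime_ideal P.
Proof. exact/asboolP/spec_valP. Qed.

Lemma spec_leE (P Q : Spec) : (P <= Q)%O = (P `<=` Q) :> Prop.
Proof. by rewrite -subsetEset. Qed.

Definition spec_of (P : set D) (hP : prime_ideal P) : Spec :=
  MkSpec (asboolT hP).

End Spec.

Section Localization.
Variables (D : idomainType) (P : Spec D).

Local Notation K := {fraction D}.
Local Notation "x %:F" := (@FracField.tofrac D x).

Definition loc_pred : {pred K} :=
  [pred x | `[< exists a b : D, ~ (P : set D) b /\ x = a%:F / b%:F >]].

Lemma loc_predP x :
  reflect (exists a b : D, ~ (P : set D) b /\ x = a%:F / b%:F)
          (x \in loc_pred).
Proof. exact: asboolP. Qed.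

Lemma spec0 : (P : set D) 0.
Proof. by have [[/set_mem]] := spec_prime P. Qed.

Lemma spec1 : ~ (P : set D) 1.
Proof. by have [[_ /negP P1 _] _] := spec_prime P => /mem_set. Qed.

Lemma specM (a b : D) :
  ~ (P : set D) a -> ~ (P : set D) b -> ~ (P : set D) (a * b).
Proof.
have [_ Pp] := spec_prime P.
by move=> Pa Pb /mem_set/Pp/orP[] /set_mem.
Qed.

Lemma specF_neq0 (b : D) : ~ (P : set D) b -> b%:F != 0.
Proof.
move=> Pb; rewrite tofrac_eq0; apply/eqP => b0; apply: Pb.
by rewrite b0; exact: spec0.
Qed.

Lemma loc_pred_subring : subring_closed loc_pred.
Proof.
split.
- by apply/loc_predP; exists 1, 1; split; [exact: spec1|rewrite tofrac1 divr1].
- move=> _ _ /loc_predP[a [b [Pb ->]]] /loc_predP[c [d [Pd ->]]].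
  apply/loc_predP; exists (a * d - c * b), (b * d); split; first exact: specM.
  have b0 := specF_neq0 Pb; have d0 := specF_neq0 Pd.
  by rewrite -mulNr addf_div // tofracB !tofracM mulNr.
- move=> _ _ /loc_predP[a [b [Pb ->]]] /loc_predP[c [d [Pd ->]]].
  apply/loc_predP; exists (a * c), (b * d); split; first exact: specM.
  by rewrite mulf_div !tofracM.
Qed.

HB.instance Definition _ :=
  GRing.isSubringClosed.Build K loc_pred loc_pred_subring.

(* D_P, as the subring { a / b | b \notin P } of the quotient field of D. *)
Record localization := Loc { loc_val :> K; _ : loc_val \in loc_pred }.

HB.instance Definition _ := [isSub for loc_val].
HB.instance Definition _ := [Choice of localization by <:].
HB.instance Definition _ := [SubChoice_isSubComNzRing of localization by <:].

Definition loc_unit : pred localization :=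
  [pred x | (loc_val x != 0) && ((loc_val x)^-1 \in loc_pred)].

Definition loc_inv (x : localization) : localization :=
  if loc_unit x then insubd x (loc_val x)^-1 else x.

Lemma loc_mulVx : {in loc_unit, left_inverse 1 loc_inv *%R}.
Proof.
move=> x xu; have /andP[x0 xV] := xu; apply: val_inj.
by rewrite /loc_inv [loc_unit x]xu rmorphM rmorph1 /= val_insubd xV mulVf.
Qed.

Lemma loc_unitP (x y : localization) : y * x = 1 -> loc_unit x.
Proof.
move=> /(congr1 val); rewrite rmorphM rmorph1 /= => yx1.
have x0 : loc_val x != 0.
  by apply/eqP => x0; move: yx1; rewrite x0 mulr0 => /esym/eqP; rewrite oner_eq0.
rewrite /loc_unit /= x0 /= -[_^-1]mul1r -yx1 mulfK //.
exact: (valP y).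
Qed.

Lemma loc_inv_out : {in [predC loc_unit], loc_inv =1 id}.
Proof. by move=> x; rewrite inE /loc_inv => /negbTE; rewrite /in_mem /= => ->. Qed.

HB.instance Definition _ :=
  GRing.ComNzRing_hasMulInverse.Build localization
    loc_mulVx loc_unitP loc_inv_out.

Lemma loc_integral (x y : localization) : x * y = 0 -> (x == 0) || (y == 0).
Proof.
move=> /(congr1 val); rewrite rmorphM rmorph0 /= => /eqP.
by rewrite mulf_eq0 -!(inj_eq val_inj) rmorph0.
Qed.

HB.instance Definition _ :=
  GRing.ComUnitRing_isIntegral.Build localization loc_integral.

End Localization.

Section Domains.
Variable D : idomainType.

Definition overrings : set (set {fraction D}) :=
  [set A | range (@FracField.tofrac D) `<=` A /\ subring_closed [in A]].

Definition h_local : Prop :=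
  (forall I : set D, ideal I -> I <> [set 0] ->
     finite_set [set M : set D | maximal_ideal M /\ I `<=` M]) /\
  (forall P : set D, prime_ideal P -> P <> [set 0] ->
     exists! M : set D, maximal_ideal M /\ P `<=` M).

Definition MPD_domain : Prop :=
  exists Q : set D,
    [/\ MNI_ideal Q, forall Q', MNI_ideal Q' -> Q' = Q &
        forall I : set D, ideal I -> I <> [set 0] -> ~ invertible I ->
          exists2 J : set D, invertible J & I = set_prod J Q].

Definition prufer_domain : Prop :=
  forall I : set D, ideal I -> fg_ideal I -> I <> [set 0] -> invertible I.

End Domains.

Arguments overrings : clear implicits.

Definition GMPD_domain (D : idomainType) : Prop :=
  h_local D /\
  forall (M : set D) (hM : maximal_ideal M),
    MPD_domain (localization (spec_of (maximal_ideal_prime hM))).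

(* Main.v *)
From HB Require Import structures.
Require Import Defs.
From mathcomp Require Import all_boot all_order all_algebra.
From mathcomp Require Import generic_quotient ring_quotient ring.
From mathcomp Require Import boolp classical_sets functions cardinality.

Set Implicit Arguments.
Unset Strict Implicit.
Unset Printing Implicit Defensive.

Import Order.TTheory GRing.Theory Num.Theory.
Import FracField.

Local Open Scope classical_set_scope.
Local Open Scope quotient_scope.
Local Open Scope ring_scope.

Local Notation "x %:F" := (@tofrac _ x).

(** Write D_M for the localization of D at a nonzero maximal ideal M. It is
    local, so its invertible ideals are principal, and every nonzero
    non-principal ideal of it is xQ for its unique MNI ideal Q. A nonzero
    non-maximal prime P of D_M cannot be principal, hence P = xQ; if x were in
    P then P would be generated by x, so x is not in P, which forces Q to lie in
    P, and P = Q ([MPD_local_nonmax_prime]). Thus below M there is at most one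
    nonzero prime other than M. The ring being h-local, the nonzero primes below
    different maximal ideals are unrelated. Since M can be recovered from the
    overring D_M, there are only finitely many M ([finite_maximal_ideals]).
    So Spec(D) is a root, the zero ideal, carrying finitely many disjoint chains
    of one or two points ([GMPD_spectrum_shape]), and such a poset is determined
    by the lengths of its chains ([spectrum_shape_isomorphic]).

    Conversely, every such shape is the spectrum of an explicit Bezout domain
    ([prufer_spectrum_shape]). Let k be the rational function field Q(t), take
    distinct centres c_i in k, and consider in k(X) the rational functions that
    are regular at every c_i and, for the indices i whose chain must have two
    points, have at c_i a value that is itself regular at t = 0. This is a
    finite intersection of pairwise independent valuation rings of rank one or
    two. Lagrange-type polynomials e_i, with value 1 at c_i and 0 at the other
    centres, replace the approximation theorem: they produce a generator of any
    finitely generated ideal ([holo_prufer]) and reduce the study of a prime to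
    a single centre ([prime_mem_at], [place_prime_complete]). There the
    vanishing of the value defines one prime, and, for a chain of two points,
    the vanishing at t = 0 of the value defines the other. *)

(** * Ideals of a domain *)

Section Ideals.
Variable A : idomainType.
Implicit Types (I J P Q m : set A) (a p r x y z : A).

Lemma idealE I : ideal I <-> I 0 /\ forall a x y, I x -> I y -> I (a * x + y).
Proof.
split=> [[/set_mem I0 Il]|[I0 Il]].
  by split=> // a x y Ix Iy; apply: set_mem; apply: (Il a); exact: mem_set.
by split=> [|a x y /set_mem Ix /set_mem Iy]; apply: mem_set => //; exact: Il.
Qed.

Lemma prime_idealE P : prime_ideal P <->
  [/\ P 0, ~ P 1, forall a x y, P x -> P y -> P (a * x + y)
    & forall x y, P (x * y) -> P x \/ P y].
Proof.
split=> [[[/set_mem P0 P1 Pl] Pp]|[P0 P1 Pl Pp]].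
  split=> // [/mem_set|a x y Px Py|x y /mem_set/Pp/orP[] /set_mem]; last 2 first.
  - by left.
  - by right.
  - exact/negP.
  - by apply: set_mem; apply: (Pl a); exact: mem_set.
split; last first.
  by move=> x y /set_mem/Pp[] /mem_set ->; rewrite ?orbT.
split; [exact: mem_set|by apply/negP => /set_mem|].
by move=> a x y /set_mem Px /set_mem Py; apply: mem_set; exact: Pl.
Qed.

Lemma prime_ideal_ideal P : prime_ideal P -> ideal P.
Proof. by move/prime_idealE => [P0 _ Pl _]; apply/idealE. Qed.

Lemma idealM I a x : ideal I -> I x -> I (a * x).
Proof. by move=> /idealE[I0 Il] Ix; rewrite -[a * x]addr0; exact: Il. Qed.

Lemma idealD I x y : ideal I -> I x -> I y -> I (x + y).
Proof. by move=> /idealE[I0 Il] Ix; rewrite -[x]mul1r; exact: Il. Qed.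

Lemma ideal_sum I n (f : 'I_n -> A) :
  ideal I -> (forall i, I (f i)) -> I (\sum_i f i).
Proof.
move=> Ii fI; elim/big_ind: _ => // [|x y]; last exact: idealD.
by have /idealE[] := Ii.
Qed.

Lemma prime_idealX P x n : prime_ideal P -> P (x ^+ n) -> P x.
Proof.
move=> /prime_idealE[_ P1 _ Pp]; elim: n => [//|n IHn].
by rewrite exprS => /Pp[].
Qed.

Lemma zero_ideal_prime : prime_ideal [set 0 : A].
Proof.
apply/prime_idealE; split=> //= [/eqP|a x y -> ->|x y /eqP].
- by rewrite oner_eq0.
- by rewrite mulr0 addr0.
- by rewrite mulf_eq0 => /orP[] /eqP; [left|right].
Qed.

Lemma zero_sub_prime P : prime_ideal P -> [set 0] `<=` P.
Proof. by move=> /prime_idealE[P0 _ _ _] _ ->. Qed.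

Definition principal x := [set y : A | exists a, y = a * x].

Lemma ideal_principal x : ideal (principal x).
Proof.
apply/idealE; split; first by exists 0; rewrite mul0r.
by move=> a _ _ [d ->] [e ->]; exists (a * d + e); rewrite mulrDl mulrA.
Qed.

Lemma principal0 : principal 0 = [set 0].
Proof.
apply/seteqP; split=> [_ [a ->]|_ ->]; first by rewrite mulr0.
by exists 0; rewrite mulr0.
Qed.

Lemma principal_invertible x : x != 0 -> invertible (principal x).
Proof.
move=> x0; have xF0 : x%:F != 0 by rewrite tofrac_eq0.
split; first exact: ideal_principal.
apply/seteqP; split=> [_ [n [f [g [fI gI ->]]]]|_ [a _ <-]].
  have /choice[h hE] : forall i, exists a : A, f i * g i = a%:F.
    move=> i; have [y Iy <-] := fI i; have [a _ aE] := gI i _ Iy.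
    by exists a; rewrite mulrC.
  exists (\sum_i h i) => //.
  by rewrite rmorph_sum; apply: eq_bigr => i _; rewrite hE.
exists 1, (fun=> (a * x)%:F), (fun=> x%:F^-1); split=> // [_|_ y [d ->]|].
- by exists (a * x) => //; exists a.
- by exists d => //; rewrite tofracM mulrC mulfK.
- by rewrite big_ord1 tofracM mulfK.
Qed.

Lemma unit_ideal_invertible : invertible [set: A].
Proof.
suff -> : [set: A] = principal 1.
  by apply: principal_invertible; rewrite oner_eq0.
by apply/seteqP; split=> // x _; exists x; rewrite mulr1.
Qed.

Definition span n (s : 'I_n -> A) :=
  [set x : A | exists d : 'I_n -> A, x = \sum_(i < n) d i * s i].

Lemma span_mem n (s : 'I_n -> A) i : span s (s i).
Proof.
exists (fun j => (j == i)%:R); rewrite (bigD1 i) //= eqxx mul1r.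
by rewrite big1 ?addr0 // => j /negPf->; rewrite mul0r.
Qed.

Lemma span_neq0 n (s : 'I_n -> A) : span s <> [set 0] -> exists i, s i != 0.
Proof.
move=> I0; apply: contrapT => /forallNP s0; apply: I0.
apply/seteqP; split=> [_ [d ->]|_ ->] /=.
  by rewrite big1 // => i _; have /negP/negbNE/eqP -> := s0 i; rewrite mulr0.
by exists (fun=> 0); rewrite big1 // => i _; rewrite mul0r.
Qed.

Lemma span_principal n (s : 'I_n -> A) x : ideal (span s) -> span s x ->
  (forall i, principal x (s i)) -> span s = principal x.
Proof.
move=> Ii Ix sx; apply/seteqP; split=> [_ [d ->]|_ [d ->]]; last exact: idealM.
apply: ideal_sum => [|i]; first exact: ideal_principal.
by apply: idealM (ideal_principal x) _.
Qed.

Lemma set_prod_principal x Q z : ideal Q ->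
  set_prod (principal x) Q z -> exists2 q, Q q & z = x * q.
Proof.
move=> Qi [n [f [g [fx gQ ->]]]].
have [h hE] := choice fx; exists (\sum_i h i * g i).
  by apply: ideal_sum => // i; exact: idealM.
by rewrite mulr_sumr; apply: eq_bigr => i _; rewrite hE; ring.
Qed.

Lemma mem_set_prod_principal x Q z : Q z -> set_prod (principal x) Q (x * z).
Proof.
exists 1, (fun=> x), (fun=> z); rewrite big_ord1; split=> // _.
by exists 1; rewrite mul1r.
Qed.

(** * Primes of local MPD domains *)

Section Local.
Variable m : set A.
Hypotheses (m_prime : prime_ideal m).
Hypothesis (m_unit : forall x, ~ m x -> exists y, y * x = 1).

(** When 1 is a sum of products of an element of I and one of its inverse,
    some product is a unit, and its factor in I generates I. *)
Lemma local_invertible_principal I :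
  invertible I -> exists x, I = principal x.
Proof.
move=> [Ii IE]; have : range (@tofrac A) 1 by exists 1 => //; exact: tofrac1.
rewrite -IE => -[n [f [g [fI gI e]]]].
have /choice[h hI] : forall i, exists a : A, I a /\ f i = a%:F.
  by move=> i; have [a] := fI i; exists a.
have /choice[r rE] : forall i, exists a : A, a%:F = g i * f i.
  move=> i; have [hi ->] := hI i.
  by have [a _] := gI i _ hi; exists a.
have [i ri] : exists i, ~ m (r i).
  apply: contrapT => /forallNP rm.
  have /prime_idealE[_ + _ _] := m_prime; apply.
  have -> : 1 = \sum_i r i.
    apply/eqP; rewrite -tofrac_eq tofrac1 rmorph_sum e; apply/eqP.
    by apply: eq_bigr => i _ /=; rewrite rE mulrC.
  apply: ideal_sum => [|i]; first exact: prime_ideal_ideal.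
  by apply: contrapT; exact: rm.
have [u ur] := m_unit ri; have [hi fE] := hI i; exists (h i).
apply/seteqP; split=> [y Iy|_ [a ->]]; last exact: idealM.
have [s _ sE] := gI i _ Iy; exists (u * s).
have : y * r i = s * h i.
  by apply/eqP; rewrite -tofrac_eq !tofracM sE rE fE; apply/eqP; ring.
by move=> /(congr1 ( *%R u)); rewrite mulrCA ur mulr1 => ->; rewrite mulrA.
Qed.

Lemma prime_sub_local P : prime_ideal P -> P `<=` m.
Proof.
move=> Pp x Px; apply: contrapT => /m_unit[y yx].
have /prime_idealE[_ + _ _] := Pp; apply; rewrite -yx.
by apply: idealM => //; exact: prime_ideal_ideal.
Qed.

(** The prime is shown to be non-principal first. Assume it is generated by p.
    For y in m outside P, the ideal (p, y) is not principal, since p is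
    irreducible; so it is of the form xQ, and Q contains all of m, that is
    Q = m. As p lies in xm and y is not in P, x is a unit and (p, y) = m. For
    y = t * t this puts t itself in (p, t * t), which is absurd. *)
Lemma MPD_local_nonmax_prime : MPD_domain A ->
  exists Q, forall P, prime_ideal P -> P <> [set 0] -> P <> m -> P = Q.
Proof.
move=> [Q [[Qi Qninv _] _ fact]]; exists Q => P Pp P0 Pm.
have Pi := prime_ideal_ideal Pp; have mi := prime_ideal_ideal m_prime.
have Psub := prime_sub_local Pp.
have /prime_idealE[_ m1 _ _] := m_prime; have /prime_idealE[_ _ _ Pmul] := Pp.
have factQ I : ideal I -> I <> [set 0] -> ~ invertible I ->
    exists x, I = set_prod (principal x) Q.
  move=> Ii I0 /(fact _ Ii I0)[J /local_invertible_principal[x ->] ->].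
  by exists x.
have subQ I : ideal I -> I <> [set 0] -> ~ invertible I -> I `<=` Q.
  move=> Ii I0 /(factQ _ Ii I0)[x ->] z /(set_prod_principal Qi)[q Qq ->].
  exact: idealM.
have Pninv : ~ invertible P.
  have [t mt nPt] : exists2 t, m t & ~ P t.
    apply: contrapT => nt; apply: Pm; apply/seteqP; split=> // t mt.
    by apply: contrapT => nPt; apply: nt; exists t.
  move=> /local_invertible_principal[p PE].
  have Pp' : P p by rewrite PE; exists 1; rewrite mul1r.
  have p0 : p != 0.
    by apply/eqP => p0; apply: P0; rewrite PE p0 principal0.
  pose gen y := [set z | exists a d, z = a * p + d * y].
  have genp y : gen y p by exists 1, 0; rewrite mul1r mul0r addr0.
  have geny y : gen y y by exists 0, 1; rewrite mul1r mul0r add0r.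
  have geni y : ideal (gen y).
    apply/idealE; split; first by exists 0, 0; rewrite !mul0r addr0.
    move=> a _ _ [d [e ->]] [d' [e' ->]].
    by exists (a * d + d'), (a * e + e'); ring.
  have gen0 y : gen y <> [set 0].
    by move=> g0; have := genp y; rewrite g0; apply/eqP.
  have genm y : m y -> gen y `<=` m.
    move=> my _ [a [d ->]]; apply: idealD => //; apply: idealM => //.
    exact: Psub.
  (* p is irreducible, so a common divisor of p and y is a unit. *)
  have genninv y : m y -> ~ P y -> ~ invertible (gen y).
    move=> my nPy /local_invertible_principal[d gE].
    have : principal d p by rewrite -gE.
    move=> [e pE]; have : P (e * d) by rewrite -pE.
    case/Pmul => [|Pd].
      rewrite {1}PE => -[g eE]; apply: m1.
      have -> : 1 = g * d by apply: (mulIf p0); rewrite mul1r {1}pE eE; ring.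
      apply: idealM => //; apply: genm my _ _; rewrite gE.
      by exists 1; rewrite mul1r.
    have : principal d y by rewrite -gE.
    by move=> [f yE]; apply: nPy; rewrite yE; exact: idealM.
  have QE : Q = m.
    apply/seteqP; split=> [q Qq|y my].
      apply: contrapT => /m_unit[u uq]; apply: Qninv.
      suff -> : Q = [set: A] by exact: unit_ideal_invertible.
      apply/seteqP; split=> // z _; rewrite -[z]mulr1 -uq mulrA.
      exact: idealM.
    have [|nPy] := pselect (P y).
      rewrite PE => -[a ->]; apply: idealM => //.
      by apply: (subQ (gen t)) => //; exact: genninv.
    by apply: (subQ (gen y)) => //; exact: genninv.
  have m_gen y : m y -> ~ P y -> m `<=` gen y.
    move=> my nPy.
    have [x gE] := factQ _ (geni y) (@gen0 y) (genninv _ my nPy).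
    have : set_prod (principal x) Q p by rewrite -gE.
    move=> /(set_prod_principal Qi)[q Qq pE].
    have : P (x * q) by rewrite -pE.
    case/Pmul => [Px|].
      have : set_prod (principal x) Q y by rewrite -gE.
      move=> /(set_prod_principal Qi)[q' Qq' yE].
      by case: nPy; rewrite yE mulrC; exact: idealM.
    rewrite PE => -[a qE] w mw.
    have xa : x * a = 1 by apply: (mulIf p0); rewrite mul1r {2}pE qE; ring.
    rewrite gE QE -[w]mul1r -xa -mulrA; apply: mem_set_prod_principal.
    exact: idealM.
  have [] := m_gen (t * t) _ _ t mt; first exact: idealM.
    by case/Pmul.
  move=> a [d tE].
  have : P (t * (1 - d * t)).
    have -> : t * (1 - d * t) = a * p by rewrite mulrBr mulr1 {1}tE; ring.
    exact: idealM.
  case/Pmul => // /Psub m1t; apply: m1.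
  rewrite -[1](subrK (d * t)); apply: idealD => //; exact: idealM.
(* P = xQ; either x lies in P and generates it, or Q is contained in P. *)
have [x PE] := factQ P Pi P0 Pninv.
apply/seteqP; split=> [|q Qq]; first exact: subQ.
have : P (x * q) by rewrite PE; exact: mem_set_prod_principal.
case/Pmul => // Px; case: Pninv.
have PEx : P = principal x.
  apply/seteqP; split=> [z|_ [a ->]]; last exact: idealM.
  rewrite PE => /(set_prod_principal Qi)[q' _ ->].
  by exists q'; rewrite mulrC.
rewrite PEx; apply: principal_invertible; apply/eqP => x0; apply: P0.
by rewrite PEx x0 principal0.
Qed.

End Local.
End Ideals.

(** * From localizations to the spectrum *)

Section LocalizedPrimes.
Variables (D : idomainType) (M : set D) (hM : maximal_ideal M).
Local Notation A := (localization (spec_of (maximal_ideal_prime hM))).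
Implicit Types (P : set D) (x y : A).

Definition extended P : set A :=
  [set x | exists a d, [/\ P a, ~ M d & loc_val x = a%:F / d%:F]].

Let M_prime : prime_ideal M := maximal_ideal_prime hM.

Let denom_neq0 d : ~ M d -> d%:F != 0.
Proof. exact: (@specF_neq0 D (spec_of M_prime)). Qed.

Let denomM d e : ~ M d -> ~ M e -> ~ M (d * e).
Proof. exact: (@specM D (spec_of M_prime)). Qed.

Lemma localizationE x :
  exists a d, ~ M d /\ loc_val x = a%:F / d%:F.
Proof. by have /loc_predP := valP x. Qed.

Lemma localization_of a d : ~ M d -> exists x : A, loc_val x = a%:F / d%:F.
Proof.
move=> Md; have xA : a%:F / d%:F \in loc_pred (spec_of M_prime).
  by apply/loc_predP; exists a, d.
by exists (Loc xA).
Qed.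

(** Membership of a fraction in the extension of P does not depend on the way
    it is written, because the denominators stay outside P. *)
Lemma extended_frac P x a d : prime_ideal P -> P `<=` M -> extended P x ->
  ~ M d -> loc_val x = a%:F / d%:F -> P a.
Proof.
move=> Pp PM [a' [d' [Pa' Md' ->]]] Md /eqP.
have /prime_idealE[_ _ _ Pmul] := Pp.
rewrite eqr_div ?denom_neq0 // -!tofracM tofrac_eq => /eqP e.
have : P (a * d').
  by rewrite -e mulrC; apply: idealM => //; exact: prime_ideal_ideal.
by case/Pmul => // /PM.
Qed.

Lemma extended_prime P : prime_ideal P -> P `<=` M -> prime_ideal (extended P).
Proof.
move=> Pp PM; have /prime_idealE[P0 P1 Pl Pmul] := Pp.
have /prime_idealE[_ M1 _ _] := M_prime.
have Pi := prime_ideal_ideal Pp.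
apply/prime_idealE; split.
- by exists 0, 1; rewrite tofrac0 mul0r.
- move=> /extended_frac-/(_ 1 1 Pp PM M1) P1'; apply: P1; apply: P1'.
  by rewrite tofrac1 divr1.
- move=> x y z [a [d [Pa Md yE]]] [a' [d' [Pa' Md' zE]]].
  have [e [f [Mf xE]]] := localizationE x.
  exists (e * a * d' + a' * (f * d)), (f * d * d'); split.
  + by apply: idealD => //; [rewrite mulrAC|rewrite mulrC]; exact: idealM.
  + by apply: denomM => //; exact: denomM.
  + rewrite -[loc_val _]/(val (x * y + z)) rmorphD rmorphM /= xE yE zE.
    rewrite mulf_div -!tofracM addf_div ?denom_neq0 //; last exact: denomM.
    by rewrite -!tofracM -tofracD.
- move=> x y xyP.
  have [a [d [Md xE]]] := localizationE x.
  have [a' [d' [Md' yE]]] := localizationE y.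
  have : P (a * a').
    apply: (extended_frac Pp PM xyP (denomM Md Md')).
    by rewrite -[loc_val _]/(val (x * y)) rmorphM /= xE yE mulf_div !tofracM.
  by case/Pmul => [Pa|Pa']; [left; exists a, d|right; exists a', d'].
Qed.

Lemma extended_inj P P' :
  prime_ideal P -> P `<=` M -> prime_ideal P' -> P' `<=` M ->
  extended P = extended P' -> P = P'.
Proof.
suff sub Q Q' : prime_ideal Q' -> Q' `<=` M ->
    extended Q = extended Q' -> Q `<=` Q'.
  by move=> Pp PM P'p P'M e; apply/seteqP; split; exact: sub.
move=> Q'p Q'M e a Qa; have /prime_idealE[_ M1 _ _] := M_prime.
have [x xE] := localization_of a M1.
apply: (@extended_frac Q' x a 1) => //.
by rewrite -e; exists a, 1.
Qed.

Lemma extended_set0 : extended [set 0] = [set 0].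
Proof.
apply/seteqP; split=> [x [_ [d [-> _ xE]]]|_ ->].
  by apply: val_inj; rewrite rmorph0 /= xE tofrac0 mul0r.
have /prime_idealE[_ M1 _ _] := M_prime.
exists 0, 1; split=> //.
by rewrite -[loc_val _]/(val (0 : A)) rmorph0 tofrac0 mul0r.
Qed.

Lemma extended_max_unit x : ~ extended M x -> exists y, y * x = 1.
Proof.
have [a [d [Md xE]]] := localizationE x => xM.
have Ma : ~ M a by move=> Ma; apply: xM; exists a, d.
have [y yE] := localization_of d Ma; exists y; apply: val_inj.
rewrite rmorphM rmorph1 /= xE yE mulf_div -!tofracM [d * a]mulrC divff //.
by rewrite denom_neq0 //; exact: denomM.
Qed.

Lemma MPD_localization_prime : MPD_domain A ->
  forall P P', prime_ideal P -> P `<=` M -> P <> [set 0] -> P <> M ->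
    prime_ideal P' -> P' `<=` M -> P' <> [set 0] -> P' <> M -> P = P'.
Proof.
have eM := extended_prime M_prime (@subset_refl _ M).
move=> /(MPD_local_nonmax_prime eM extended_max_unit)[Q QE].
have z := @zero_ideal_prime D.
have ext P : prime_ideal P -> P `<=` M -> P <> [set 0] -> P <> M ->
    extended P = Q.
  move=> Pp PM P0 PnM; apply: QE; first exact: extended_prime.
    rewrite -extended_set0 => /extended_inj e; apply: P0; apply: e => //.
    exact: zero_sub_prime.
  by move=> /extended_inj e; apply: PnM; exact: e.
move=> P P' Pp PM P0 PnM P'p P'M P'0 P'nM; apply: extended_inj => //.
by rewrite !ext.
Qed.

End LocalizedPrimes.

(** A maximal ideal M is determined by D_M: its nonzero elements are those
    whose inverse is not in D_M. *)
Lemma finite_maximal_ideals (D : idomainType) : finite_set (overrings D) ->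
  finite_set [set M : set D | maximal_ideal M].
Proof.
move=> fin.
pose nonunits (B : set {fraction D}) := [set a : D | a = 0 \/ ~ B (a%:F)^-1].
apply: (sub_finite_set _ (finite_image nonunits fin)) => M hM.
have M_prime := maximal_ideal_prime hM.
have /prime_idealE[M0 M1 _ _] := M_prime.
pose P := spec_of M_prime.
exists [set x | x \in loc_pred P].
  split=> [_ [a _ <-]|].
    by apply/loc_predP; exists a, 1; rewrite tofrac1 divr1.
  have [o s p] := loc_pred_subring P.
  have E x : (x \in [set x | x \in loc_pred P]) = (x \in loc_pred P).
    by apply/idP/idP => [/set_mem|xM] //; exact: mem_set.
  by split=> [|x y|x y]; rewrite !E; [exact: o|exact: s|exact: p].
apply/seteqP; split=> a.
  move=> [->//|aM]; apply: contrapT => Ma; apply: aM; apply/loc_predP.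
  by exists 1, a; rewrite tofrac1 div1r.
move=> Ma; have [->|a0] := eqVneq a 0; [by left|right].
have aF0 : a%:F != 0 by rewrite tofrac_eq0.
move=> /loc_predP[d [e [Me /eqP]]].
rewrite -[a%:F^-1]div1r eqr_div //; last exact: (@specF_neq0 D P).
rewrite mul1r -tofracM tofrac_eq => /eqP eE; apply: Me; rewrite eE /=.
by apply: idealM => //; exact: prime_ideal_ideal.
Qed.

(** The zero ideal is the root. Above it, the i-th chain is
    Q i false < Q i true if b i holds, and a single point
    Q i false = Q i true otherwise; distinct chains are incomparable. *)
Definition spectrum_shape (D : idomainType) n (b : 'I_n -> bool) :=
  exists Q : 'I_n -> bool -> set D,
  [/\ forall i s, prime_ideal (Q i s) /\ Q i s <> [set 0],
      forall P, prime_ideal P -> P <> [set 0] -> exists i s, P = Q i s &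
      forall i j s t, Q i s `<=` Q j t <-> i = j /\ (s && b i -> t)].

(** A relation suffices because, where it preserves and reflects the order, it
    is single-valued in both directions by antisymmetry. *)
Lemma poset_isomorphic_rel d d' (U : porderType d) (V : porderType d')
    (r : U -> V -> Prop) :
  (forall x, exists y, r x y) -> (forall y, exists x, r x y) ->
  (forall x x' y y', r x y -> r x' y' -> (x <= x')%O = (y <= y')%O) ->
  poset_isomorphic U V.
Proof.
move=> /choice[f rf] /choice[g rg] rle; exists f, g; split.
- by move=> x; apply/eqP; rewrite eq_le !(rle _ _ _ _ (rg _) (rf _))
    !(rle _ _ _ _ (rf _) (rg _)) lexx.
- by move=> y; apply/eqP; rewrite eq_le -!(rle _ _ _ _ (rg _) (rf _))
    -!(rle _ _ _ _ (rf _) (rg _)) lexx.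
- by move=> x x'; rewrite (rle _ _ _ _ (rf x) (rf x')).
- by move=> y y'; rewrite (rle _ _ _ _ (rg y) (rg y')).
Qed.

Lemma spectrum_shape_isomorphic (D R : idomainType) n (b : 'I_n -> bool) :
  spectrum_shape D b -> spectrum_shape R b ->
  poset_isomorphic (Spec D) (Spec R).
Proof.
move=> [Q [Qp Qall Qle]] [Q' [Q'p Q'all Q'le]].
pose r (x : Spec D) (y : Spec R) :=
  ((x : set D) = [set 0] /\ (y : set R) = [set 0]) \/
  exists i s, (x : set D) = Q i s /\ (y : set R) = Q' i s.
apply: (@poset_isomorphic_rel _ _ _ _ r).
- move=> x; have [x0|x0] := pselect ((x : set D) = [set 0]).
    by exists (spec_of (@zero_ideal_prime R)); left.
  have [i [s xE]] := Qall _ (spec_prime x) x0.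
  by exists (spec_of (Q'p i s).1); right; exists i, s.
- move=> y; have [y0|y0] := pselect ((y : set R) = [set 0]).
    by exists (spec_of (@zero_ideal_prime D)); left.
  have [i [s yE]] := Q'all _ (spec_prime y) y0.
  by exists (spec_of (Qp i s).1); right; exists i, s.
have sub0 (A : idomainType) (P : set A) :
    prime_ideal P -> P `<=` [set 0] -> P = [set 0].
  by move=> /zero_sub_prime P0 ?; apply/seteqP.
move=> x x' y y' rxy rx'y'; apply/idP/idP; rewrite !spec_leE.
  case: rx'y' => [[-> ->]|[j [t [-> ->]]]]; case: rxy => [[-> ->]|[i [s [-> ->]]]].
  - by move=> _ z ->.
  - by move=> /(sub0 _ _ (Qp i s).1)/(Qp i s).2.
  - by move=> _; exact: zero_sub_prime (Q'p j t).1.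
  - by move=> /Qle/Q'le.
case: rx'y' => [[-> ->]|[j [t [-> ->]]]]; case: rxy => [[-> ->]|[i [s [-> ->]]]].
- by move=> _ z ->.
- by move=> /(sub0 _ _ (Q'p i s).1)/(Q'p i s).2.
- by move=> _; exact: zero_sub_prime (Qp j t).1.
- by move=> /Q'le/Qle.
Qed.

(** For a field D the zero ideal is maximal, so the chains are indexed by the
    nonzero maximal ideals only. *)
Lemma GMPD_spectrum_shape (D : idomainType) :
  GMPD_domain D -> finite_set (overrings D) ->
  exists n (b : 'I_n -> bool), spectrum_shape D b.
Proof.
move=> [[_ uniq_max] mpd] /finite_maximal_ideals fin.
have max_eq (P M N : set D) : prime_ideal P -> P <> [set 0] ->
    maximal_ideal M -> P `<=` M -> maximal_ideal N -> P `<=` N -> M = N.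
  move=> Pp P0 hM PM hN PN; have [L [_ uL]] := uniq_max P Pp P0.
  by rewrite -(uL M) // -(uL N).
have [s sE] : exists s : seq (set D),
    [set M | maximal_ideal M /\ M <> [set 0]] = [set` s].
  by apply/finite_seqP; apply: sub_finite_set fin => M [].
pose top (i : 'I_(size (undup s))) := nth [set 0] (undup s) i.
have topP i : maximal_ideal (top i) /\ top i <> [set 0].
  suff : [set` s] (top i) by rewrite -sE.
  by rewrite /= -mem_undup mem_nth.
have top_inj : injective top.
  by move=> i j /eqP; rewrite nth_uniq ?undup_uniq // => /eqP/val_inj.
have topS M : maximal_ideal M -> M <> [set 0] -> exists i, M = top i.
  move=> hM M0; have : [set` s] M by rewrite -sE.
  rewrite /= -mem_undup -index_mem => lt; exists (Ordinal lt).
  by rewrite /top /= nth_index // -index_mem.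
pose mid i P := [/\ prime_ideal P, P <> [set 0], P `<=` top i & P <> top i].
pose b i := `[< exists P, mid i P >].
have /choice[bot botP] : forall i, exists P, if b i then mid i P else P = top i.
  by move=> i; rewrite /b; case: asboolP => // _; exists (top i).
pose Q i (t : bool) := if t then top i else bot i.
have QP i t : [/\ prime_ideal (Q i t), Q i t <> [set 0] & Q i t `<=` top i].
  have [hM M0] := topP i; have Mp := maximal_ideal_prime hM.
  case: t; first by split.
  by have := botP i; rewrite /Q; case: (b i) => [[] *|->]; split.
exists _, b, Q; split.
- by move=> i t; have [] := QP i t.
- move=> P Pp P0; have [M [[hM PM] _]] := uniq_max P Pp P0.
  have M0 : M <> [set 0].
    move=> M0; apply: P0; apply/seteqP; split; last exact: zero_sub_prime.
    by rewrite -M0.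
  have [i ME] := topS M hM M0; exists i; rewrite {}ME in PM hM M0.
  have [PE|PE] := pselect (P = top i); first by exists true.
  have bi : b i by apply/asboolP; exists P.
  exists false; have := botP i; rewrite bi => -[Bp B0 BM BE].
  exact: (MPD_localization_prime (mpd _ hM)).
- move=> i j u t; have [Qp Q0 Qi] := QP i u; have [_ _ Qj] := QP j t.
  split=> [sub|[<-{j Qj} ut]].
    have ij : i = j.
      apply: top_inj; apply: (max_eq (Q i u)) => //.
      - exact: (topP i).1.
      - exact: (topP j).1.
      - exact: subset_trans Qj.
    split=> // /andP[uT bi]; move: sub.
    rewrite -{}ij uT /Q; case: t {Qj} => //= sub.
    have := botP i; rewrite bi => -[_ _ BM []].
    by apply/seteqP.
  case: t ut => //; rewrite /Q; case: u {Qp Q0 Qi} => /= bi; last exact: subset_refl.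
  by have := botP i; case: (b i) bi => [/(_ isT)|_ ->].
Qed.
(** * Values of rational functions at a point *)

Lemma fraction_quotient (A : idomainType) (x : {fraction A}) :
  exists f g : A, g != 0 /\ x = f%:F / g%:F.
Proof.
elim/quotW: x => x; exists x.1, x.2; split; first exact: denom_ratioP.
have xF0 : x.2%:F != 0 by rewrite tofrac_eq0 denom_ratioP.
apply: (mulIf xF0); rewrite divfK //.
apply/eqP; rewrite -[X in X == _]/(FracField.mul _ _) !piE /FracField.equivf.
rewrite /mulf !numden_Ratio ?mulf_neq0 ?oner_eq0 ?denom_ratioP //.
by rewrite !mulr1 mulrC.
Qed.

Section Place.
Variables (F : fieldType) (c : F).
Local Notation K := {fraction {poly F}}.
Implicit Types (x y : K) (v w : F) (p f g : {poly F}).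

(** A relation and not a function, since x may have a pole at c; it is the
    graph of the residue map of the X - c valuation ring. *)
Definition value_at x v :=
  exists f g, [/\ g.[c] != 0, x = f%:F / g%:F & v = f.[c] / g.[c]].

Let neq0 g : g.[c] != 0 -> g%:F != 0 :> K.
Proof. by apply: contra; rewrite tofrac_eq0 => /eqP->; rewrite horner0. Qed.

Lemma value_at_uniq x v w : value_at x v -> value_at x w -> v = w.
Proof.
move=> [f [g [g0 -> ->]]] [f' [g' [g'0 /eqP + ->]]].
rewrite eqr_div ?neq0 // -!tofracM tofrac_eq => /eqP e.
by apply/eqP; rewrite eqr_div // -!hornerM e.
Qed.

Lemma value_at_poly p : value_at p%:F p.[c].
Proof. by exists p, 1; rewrite hornerC oner_eq0 tofrac1 !divr1. Qed.

Lemma value_at1 : value_at 1 1.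
Proof. by rewrite -tofrac1; have := value_at_poly 1; rewrite hornerC. Qed.

Lemma value_at0 : value_at 0 0.
Proof. by rewrite -tofrac0; have := value_at_poly 0; rewrite hornerC. Qed.

Lemma value_atD x y v w :
  value_at x v -> value_at y w -> value_at (x + y) (v + w).
Proof.
move=> [f [g [g0 -> ->]]] [f' [g' [g'0 -> ->]]].
exists (f * g' + f' * g), (g * g').
by rewrite !(tofracM, tofracD, hornerM, hornerD) mulf_neq0 // !addf_div // neq0.
Qed.

Lemma value_atM x y v w :
  value_at x v -> value_at y w -> value_at (x * y) (v * w).
Proof.
move=> [f [g [g0 -> ->]]] [f' [g' [g'0 -> ->]]].
exists (f * f'), (g * g').
by rewrite !(tofracM, hornerM) mulf_neq0 // !mulf_div.
Qed.

Lemma value_atN x v : value_at x v -> value_at (- x) (- v).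
Proof.
move=> xv; rewrite -[- x]mulN1r -[- v]mulN1r; apply: value_atM => //.
by have := value_at_poly (- 1); rewrite hornerN hornerC tofracN tofrac1.
Qed.

Lemma value_atX x v n : value_at x v -> value_at (x ^+ n) (v ^+ n).
Proof.
move=> xv; elim: n => [|n IHn]; first exact: value_at1.
by rewrite !exprS; apply: value_atM.
Qed.

Lemma value_atV x v : value_at x v -> v != 0 -> value_at x^-1 v^-1.
Proof.
move=> [f [g [g0 -> ->]]] v0; exists g, f; rewrite !invf_div; split=> //.
by apply: contra v0 => /eqP->; rewrite mul0r.
Qed.

(** Every nonzero element of K is a power of X - c, with integral exponent,
    times an element with a nonzero value at c. *)
Lemma value_at_total x : (exists v, value_at x v) \/ value_at x^-1 0.
Proof.
have [f [g [g0 ->]]] := fraction_quotient x.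
have [->|f0] := eqVneq f 0.
  by left; exists 0; rewrite tofrac0 mul0r; exact: value_at0.
have [m [f1 + fE]] := multiplicity_XsubC f c; rewrite f0 /= => f1c.
have [n [g1 + gE]] := multiplicity_XsubC g c; rewrite g0 /= => g1c.
have t0 k : (('X - c%:P) ^+ k)%:F != 0 :> K.
  by rewrite tofrac_eq0 expf_neq0 // polyXsubC_eq0.
have [nm|mn] := leqP n m.
  left; exists ((f1 * ('X - c%:P) ^+ (m - n)).[c] / g1.[c]).
  exists (f1 * ('X - c%:P) ^+ (m - n)), g1; split=> //.
  by rewrite {1}fE gE -{1}(subnK nm) exprD mulrA !(tofracM _ (_ ^+ n)) -mulf_div
             divff // mulr1.
right; exists (g1 * ('X - c%:P) ^+ (n - m)), f1; split=> //.
  rewrite invf_div fE {1}gE -{1}(subnK (ltnW mn)) exprD mulrA.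
  by rewrite !(tofracM _ (_ ^+ m)) -mulf_div divff // mulr1.
rewrite hornerM horner_exp hornerXsubC subrr expr0n subn_eq0 leqNgt mn.
by rewrite mulr0 mul0r.
Qed.

(** The valuation at c has rank one: a pole of y of any order is cancelled by a
    sufficiently high power of a function vanishing at c. *)
Lemma value_at_archimedean x y :
  value_at x 0 -> exists n, value_at (x ^+ n * y) 0.
Proof.
move=> [p [q [q0 -> pc0]]].
have /factor_theorem[p1 pE] : root p c.
  by move/esym/eqP: pc0; rewrite mulf_eq0 invr_eq0 (negbTE q0) orbF.
have [f [g [g0 ->]]] := fraction_quotient y.
have [n [g1 + gE]] := multiplicity_XsubC g c; rewrite g0 /= => g1c.
exists n.+1, (p1 ^+ n.+1 * ('X - c%:P) * f), (q ^+ n.+1 * g1).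
have t0 : (('X - c%:P) ^+ n)%:F != 0 :> K.
  by rewrite tofrac_eq0 expf_neq0 // polyXsubC_eq0.
split; first by rewrite hornerM horner_exp mulf_neq0 ?expf_neq0.
  rewrite expr_div_n -!tofracXn mulf_div -!tofracM.
  have -> : p ^+ n.+1 * f = p1 ^+ n.+1 * ('X - c%:P) * f * ('X - c%:P) ^+ n.
    by rewrite pE exprMn (exprSr ('X - c%:P)); ring.
  have -> : q ^+ n.+1 * g = q ^+ n.+1 * g1 * ('X - c%:P) ^+ n.
    by rewrite {1}gE mulrA.
  by rewrite !(tofracM _ (_ ^+ n)) -mulf_div divff // mulr1.
by rewrite !hornerM hornerXsubC subrr mulr0 !mul0r.
Qed.

End Place.

(** The factor X / c_i, an additional centre at 0, is there to make p differ
    from 1 even when c_i is the only centre. *)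
Lemma interpolation_poly (F : fieldType) n (c : 'I_n -> F) i :
  injective c -> (forall j, c j != 0) -> exists p : {poly F},
  [/\ p.[c i] = 1, forall j, j != i -> p.[c j] = 0 & p != 1].
Proof.
move=> c_inj c_neq0.
exists (\prod_(j | j != i) ((c i - c j)^-1 *: ('X - (c j)%:P)) *
  ((c i)^-1 *: 'X)).
split.
- rewrite hornerM hornerZ hornerX mulVf // mulr1 horner_prod big1 // => j ji.
  rewrite hornerZ hornerXsubC mulVf // subr_eq0.
  by apply: contra ji => /eqP/c_inj ->.
- move=> j ji; rewrite hornerM horner_prod (bigD1 j) //= hornerZ hornerXsubC.
  by rewrite subrr mulr0 !mul0r.
apply/eqP => /(congr1 (horner^~ 0))/eqP.
by rewrite hornerM hornerZ hornerX !mulr0 hornerC eq_sym oner_eq0.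
Qed.

(** * A Bezout domain with prescribed spectrum *)

Section PrescribedSpectrum.
Variables (F : fieldType) (n : nat) (b : 'I_n -> bool).
Local Notation k := {fraction {poly F}}.
Local Notation K := {fraction {poly k}}.
Variable c : 'I_n -> k.
Implicit Types (i j : 'I_n) (v w : k) (x y : K).

(** The valuation ring of the residue field k at the centre c_i: the local ring
    of F(t) at t = 0 if b i holds, and k itself otherwise. *)
Definition residue_ring i v := b i -> exists a, value_at 0 v a.

Definition residue_max i v := if b i then value_at 0 v 0 else v = 0.

(** The composite of the valuation at c_i with that of [residue_ring i], of rank
    two if b i holds and of rank one otherwise. *)
Definition val_ring i x := exists2 v, value_at (c i) x v & residue_ring i v.

Definition val_max i x := exists2 v, value_at (c i) x v & residue_max i v.

Lemma residue_ring0 i : residue_ring i 0.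
Proof. by move=> _; exists 0; exact: value_at0. Qed.

Lemma residue_ring1 i : residue_ring i 1.
Proof. by move=> _; exists 1; exact: value_at1. Qed.

Lemma residue_ringD i v w :
  residue_ring i v -> residue_ring i w -> residue_ring i (v + w).
Proof.
move=> vO wO bi; have [a va] := vO bi; have [d wd] := wO bi.
by exists (a + d); exact: value_atD.
Qed.

Lemma residue_ringM i v w :
  residue_ring i v -> residue_ring i w -> residue_ring i (v * w).
Proof.
move=> vO wO bi; have [a va] := vO bi; have [d wd] := wO bi.
by exists (a * d); exact: value_atM.
Qed.

Lemma residue_ringN i v : residue_ring i v -> residue_ring i (- v).
Proof.
by move=> vO bi; have [a va] := vO bi; exists (- a); exact: value_atN.
Qed.

Lemma residue_ringV i v : residue_ring i v \/ residue_ring i v^-1.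
Proof.
have [vO|v0] := value_at_total 0 v; first by left.
by right => _; exists 0.
Qed.

Lemma residue_maxD i v w :
  residue_max i v -> residue_max i w -> residue_max i (v + w).
Proof.
rewrite /residue_max; case: (b i) => [vm wm|-> ->]; last by rewrite addr0.
by rewrite -[X in value_at _ _ X](addr0 0); exact: value_atD.
Qed.

Lemma residue_maxM i v w :
  residue_ring i v -> residue_max i w -> residue_max i (v * w).
Proof.
rewrite /residue_max /residue_ring; case: (b i) => [vO wm|_ ->].
  have [a va] := vO isT; rewrite -[X in value_at _ _ X](mulr0 a).
  exact: value_atM.
by rewrite mulr0.
Qed.

Lemma residue_max1 i : ~ residue_max i 1.
Proof.
rewrite /residue_max; case: (b i) => [m1|/eqP]; last by rewrite oner_eq0.
by have /eqP := value_at_uniq m1 (value_at1 0); rewrite eq_sym oner_eq0.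
Qed.

Lemma residue_unit i v : residue_ring i v -> ~ residue_max i v ->
  v != 0 /\ residue_ring i v^-1.
Proof.
rewrite /residue_max /residue_ring; case: (b i) => [vO vm|_ v0]; last first.
  by split=> //; apply/eqP.
have [a va] := vO isT.
have a0 : a != 0 by apply/eqP => a0; apply: vm; rewrite a0 in va.
split; last by move=> _; exists a^-1; exact: value_atV.
by apply: contra_not_neq vm => ->; exact: value_at0.
Qed.

(** In rank one the valuation is archimedean, and without valuation nothing is
    to be cancelled. *)
Lemma residue_archimedean i v w :
  residue_max i v -> exists m, residue_ring i (v ^+ m * w).
Proof.
rewrite /residue_max /residue_ring; case: (b i) => [vm|_]; last by exists 0.
by have [m vmw] := value_at_archimedean w vm; exists m => _; exists 0.
Qed.

Lemma val_ring1 i : val_ring i 1.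
Proof. by exists 1; [exact: value_at1|exact: residue_ring1]. Qed.

Lemma val_ring0 i : val_ring i 0.
Proof. by exists 0; [exact: value_at0|exact: residue_ring0]. Qed.

Lemma val_ringD i x y : val_ring i x -> val_ring i y -> val_ring i (x + y).
Proof.
move=> [v xv vO] [w yw wO]; exists (v + w); first exact: value_atD.
exact: residue_ringD.
Qed.

Lemma val_ringN i x : val_ring i x -> val_ring i (- x).
Proof.
by move=> [v xv vO]; exists (- v); [exact: value_atN|exact: residue_ringN].
Qed.

Lemma val_ringM i x y : val_ring i x -> val_ring i y -> val_ring i (x * y).
Proof.
move=> [v xv vO] [w yw wO]; exists (v * w); first exact: value_atM.
exact: residue_ringM.
Qed.

Lemma val_ringX i x m : val_ring i x -> val_ring i (x ^+ m).
Proof.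
move=> xV; elim: m => [|m IHm]; first exact: val_ring1.
by rewrite exprS; exact: val_ringM.
Qed.

Lemma val_ringV i x : val_ring i x \/ val_ring i x^-1.
Proof.
have [[v xv]|x0] := value_at_total (c i) x; last first.
  by right; exists 0 => //; exact: residue_ring0.
have [vO|vO] := residue_ringV i v; first by left; exists v.
have [v0|v0] := eqVneq v 0; last by right; exists v^-1 => //; exact: value_atV.
by left; exists v => //; rewrite v0; exact: residue_ring0.
Qed.

Lemma val_maxD i x y : val_max i x -> val_max i y -> val_max i (x + y).
Proof.
move=> [v xv vm] [w yw wm]; exists (v + w); first exact: value_atD.
exact: residue_maxD.
Qed.

Lemma val_maxM i x y : val_ring i x -> val_max i y -> val_max i (x * y).
Proof.
move=> [v xv vO] [w yw wm]; exists (v * w); first exact: value_atM.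
exact: residue_maxM.
Qed.

Lemma val_max1 i : ~ val_max i 1.
Proof.
by move=> [v /(value_at_uniq (value_at1 _)) <-]; exact: residue_max1.
Qed.

Lemma val_max_prime i x y : val_ring i x -> val_ring i y ->
  val_max i (x * y) -> val_max i x \/ val_max i y.
Proof.
move=> [v xv vO] [w yw wO] [_ /(value_at_uniq (value_atM xv yw)) <- vwm].
have [vm|vm] := pselect (residue_max i v); first by left; exists v.
have [v0 vVO] := residue_unit vO vm; right; exists w => //.
by rewrite -(mulKf v0 w); exact: residue_maxM.
Qed.

Lemma val_max_of_zero i x : value_at (c i) x 0 -> val_max i x.
Proof.
move=> x0; exists 0 => //; rewrite /residue_max; case: (b i) => //.
exact: value_at0.
Qed.

Lemma val_ringV_of_one i x : value_at (c i) x 1 -> val_ring i x^-1.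
Proof.
move=> x1; exists 1; last exact: residue_ring1.
by rewrite -[X in value_at _ _ X]invr1; apply: value_atV; rewrite ?oner_eq0.
Qed.

Definition holo_pred : {pred K} := [pred x | `[< forall i, val_ring i x >]].

Lemma holo_predP x : reflect (forall i, val_ring i x) (x \in holo_pred).
Proof. exact: asboolP. Qed.

Lemma holo_pred_subring : subring_closed holo_pred.
Proof.
split.
- by apply/holo_predP => i; exact: val_ring1.
- move=> x y /holo_predP xV /holo_predP yV; apply/holo_predP => i.
  by apply: val_ringD => //; exact: val_ringN.
- move=> x y /holo_predP xV /holo_predP yV; apply/holo_predP => i.
  exact: val_ringM.
Qed.

HB.instance Definition _ :=
  GRing.isSubringClosed.Build K holo_pred holo_pred_subring.

Record holomorphy_ring := Holo { holo_val :> K; _ : holo_val \in holo_pred }.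

HB.instance Definition _ := [isSub for holo_val].
HB.instance Definition _ := [Choice of holomorphy_ring by <:].
HB.instance Definition _ := [SubChoice_isSubComNzRing of holomorphy_ring by <:].

Definition holo_unit : pred holomorphy_ring :=
  [pred x | (holo_val x != 0) && ((holo_val x)^-1 \in holo_pred)].

Definition holo_inv (x : holomorphy_ring) : holomorphy_ring :=
  if holo_unit x then insubd x (holo_val x)^-1 else x.

Lemma holo_mulVx : {in holo_unit, left_inverse 1 holo_inv *%R}.
Proof.
move=> x xu; have /andP[x0 xV] := xu; apply: val_inj.
by rewrite /holo_inv [holo_unit x]xu rmorphM rmorph1 /= val_insubd xV mulVf.
Qed.

Lemma holo_unitP (x y : holomorphy_ring) : y * x = 1 -> holo_unit x.
Proof.
move=> /(congr1 val); rewrite rmorphM rmorph1 /= => yx1.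
have x0 : holo_val x != 0.
  apply/eqP => x0; move: yx1; rewrite x0 mulr0 => /esym/eqP.
  by rewrite oner_eq0.
by rewrite /holo_unit /= x0 -[_^-1]mul1r -yx1 mulfK //; exact: (valP y).
Qed.

Lemma holo_inv_out : {in [predC holo_unit], holo_inv =1 id}.
Proof.
by move=> x; rewrite inE /holo_inv => /negbTE; rewrite /in_mem /= => ->.
Qed.

HB.instance Definition _ :=
  GRing.ComNzRing_hasMulInverse.Build holomorphy_ring
    holo_mulVx holo_unitP holo_inv_out.

Lemma holo_integral (x y : holomorphy_ring) : x * y = 0 -> (x == 0) || (y == 0).
Proof.
move=> /(congr1 val); rewrite rmorphM rmorph0 /= => /eqP.
by rewrite mulf_eq0 -!(inj_eq val_inj) rmorph0.
Qed.

HB.instance Definition _ :=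
  GRing.ComUnitRing_isIntegral.Build holomorphy_ring holo_integral.


Lemma holo_valB (x y : holomorphy_ring) :
  holo_val (x - y) = holo_val x - holo_val y.
Proof. exact: (rmorphB val). Qed.

Lemma holo_valD (x y : holomorphy_ring) :
  holo_val (x + y) = holo_val x + holo_val y.
Proof. exact: (rmorphD val). Qed.

Lemma holo_valM (x y : holomorphy_ring) :
  holo_val (x * y) = holo_val x * holo_val y.
Proof. exact: (rmorphM val). Qed.

Lemma holo_valX (x : holomorphy_ring) m : holo_val (x ^+ m) = holo_val x ^+ m.
Proof. exact: (rmorphXn val). Qed.

Lemma holo_val1 : holo_val 1 = 1. Proof. exact: (rmorph1 val). Qed.

Lemma holo_val0 : holo_val 0 = 0. Proof. exact: (rmorph0 val). Qed.

Lemma holo_val_sum m (f : 'I_m -> holomorphy_ring) :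
  holo_val (\sum_i f i) = \sum_i holo_val (f i).
Proof. exact: (rmorph_sum val). Qed.

Lemma holo_val_eq0 (x : holomorphy_ring) : (holo_val x == 0) = (x == 0).
Proof. by rewrite -holo_val0 (inj_eq val_inj). Qed.

Lemma holo_valP (x : holomorphy_ring) i : val_ring i (holo_val x).
Proof. by have /holo_predP := valP x. Qed.

Lemma holo_dvd (x y : holomorphy_ring) : y != 0 ->
  (forall i, val_ring i (holo_val x / holo_val y)) -> principal y x.
Proof.
rewrite -holo_val_eq0 => y0 xyV.
have zP : holo_val x / holo_val y \in holo_pred by apply/holo_predP.
by exists (Holo zP); apply: val_inj; rewrite rmorphM /= divfK.
Qed.

Lemma holo_poly (p : {poly k}) : (forall i, residue_ring i p.[c i]) ->
  exists x : holomorphy_ring, holo_val x = p%:F.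
Proof.
move=> pO; have pP : p%:F \in holo_pred.
  by apply/holo_predP => i; exists p.[c i] => //; exact: value_at_poly.
by exists (Holo pP).
Qed.

Section Separators.
Hypotheses (c_inj : injective c) (c_neq0 : forall i, c i != 0).

Lemma holo_separator i : exists e : holomorphy_ring,
  [/\ value_at (c i) (holo_val e) 1,
      forall j, j != i -> value_at (c j) (holo_val e) 0 & e != 1].
Proof.
have [p [pi pj p0]] := interpolation_poly i c_inj c_neq0.
have [|e eE] := @holo_poly p.
  move=> j; have [->|ji] := eqVneq j i.
    by rewrite pi; exact: residue_ring1.
  by rewrite pj //; exact: residue_ring0.
exists e; rewrite eE; split.
- by rewrite -pi; exact: value_at_poly.
- by move=> j /pj <-; exact: value_at_poly.
by apply: contra p0 => /eqP e1; rewrite -tofrac_eq -eE e1 holo_val1 tofrac1.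
Qed.
End Separators.

Section Spectrum.
Variable e : 'I_n -> holomorphy_ring.
Hypotheses (e_diag : forall i, value_at (c i) (holo_val (e i)) 1)
  (e_off : forall i j, j != i -> value_at (c j) (holo_val (e i)) 0)
  (e_neq1 : forall i, e i != 1).

(** The principal ideals of a valuation ring form a chain. *)
Lemma val_ring_min i m (s : 'I_m -> holomorphy_ring) h0 : s h0 != 0 ->
  exists h, s h != 0 /\
    forall l, val_ring i (holo_val (s l) / holo_val (s h)).
Proof.
move=> s0.
pose r (l h : 'I_m) := `[< val_ring i (holo_val (s h) / holo_val (s l)) >].
have r_refl : {in [pred l | s l != 0], reflexive r}.
  move=> l sl0; apply/asboolP; rewrite divff ?holo_val_eq0 //.
  exact: val_ring1.
have r_trans : {in [pred l | s l != 0] & &, transitive r}.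
  move=> l h g sl0 _ _ /asboolP jl /asboolP lh; apply/asboolP.
  rewrite -[X in val_ring _ X](_ : holo_val (s g) / holo_val (s l) *
    (holo_val (s l) / holo_val (s h)) = _); first exact: val_ringM.
  by rewrite mulrA divfK ?holo_val_eq0.
have r_total : {in [pred l | s l != 0] &, total r}.
  move=> l h _ _; apply/orP.
  have [V|V] := val_ringV i (holo_val (s h) / holo_val (s l)).
    by left; apply/asboolP.
  by right; apply/asboolP; rewrite -invf_div.
have [h sj0 hmin] := extremum_inP r_refl r_trans r_total s0.
exists h; split=> // l.
have [->|sl0] := eqVneq (s l) 0; last exact/asboolP/hmin.
by rewrite holo_val0 mul0r; exact: val_ring0.
Qed.

(** Let s (q i) be a generator of smallest valuation at c_i. The sum a of the
    e i * s (q i) has a quotient by s (q i) with value 1 at c_i, so a has the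
    least valuation at every centre at once, and generates the ideal. *)
Lemma holo_prufer : prufer_domain (holomorphy_ring : idomainType).
Proof.
move=> I Ii [m [s IE]] I0.
have {}IE : I = span s := IE; rewrite {}IE in Ii I0 *.
have [h0 sh0] := span_neq0 I0.
suff [a [Ia a0 aV]] : exists a : holomorphy_ring, [/\ span s a, a != 0 &
    forall l i, val_ring i (holo_val (s l) / holo_val a)].
  rewrite (span_principal Ii Ia); first exact: principal_invertible.
  by move=> l; exact: holo_dvd.
(* Without centres the ring is the field k(X), and the sum a would be 0. *)
have [[i0]|n0] := pselect (exists i : 'I_n, True); last first.
  by exists (s h0); split=> //; [exact: span_mem|] => l i; case: n0; exists i.
move=> _; have /choice[q qP] : forall i, exists h, s h != 0 /\
    forall l, val_ring i (holo_val (s l) / holo_val (s h)).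
  by move=> i; exact: val_ring_min sh0.
pose a : holomorphy_ring := \sum_i e i * s (q i).
have aE i : value_at (c i) (holo_val a / holo_val (s (q i))) 1.
  have [sq0 qV] := qP i.
  rewrite holo_val_sum (bigD1 i) // holo_valM mulrDl mulfK ?holo_val_eq0 //.
  rewrite -[X in value_at _ _ X]addr0; apply: value_atD => //.
  rewrite mulr_suml; elim/big_ind: _ => [|x y x0 y0|j ji].
  - exact: value_at0.
  - by rewrite -[X in value_at _ _ X]addr0; exact: value_atD.
  rewrite holo_valM -mulrA; have [v xv _] := qV (q j).
  rewrite -[X in value_at _ _ X](mul0r v); apply: value_atM => //.
  by apply: e_off; rewrite eq_sym.
have a0 : a != 0.
  apply/eqP => a0; have := aE i0; rewrite a0 holo_val0 mul0r.
  by move=> /(value_at_uniq (value_at0 _))/eqP; rewrite eq_sym oner_eq0.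
exists a; split=> //.
  by apply: ideal_sum => // i; apply: idealM => //; exact: span_mem.
move=> l i; have [sq0 qV] := qP i.
have -> : holo_val (s l) / holo_val a = holo_val (s l) / holo_val (s (q i)) *
    (holo_val a / holo_val (s (q i)))^-1.
  by rewrite invf_div mulrA divfK ?holo_val_eq0.
by apply: val_ringM => //; exact: val_ringV_of_one.
Qed.

(** * The nonzero primes *)

Lemma compl_diag i : value_at (c i) (holo_val (1 - e i)) 0.
Proof.
rewrite holo_valB holo_val1 -[X in value_at _ _ X](subrr 1).
apply: value_atD; first exact: value_at1.
exact: value_atN.
Qed.

Lemma compl_off i j : j != i -> value_at (c j) (holo_val (1 - e i)) 1.
Proof.
move=> ji; rewrite holo_valB holo_val1 -[X in value_at _ _ X](subr0 1).
apply: value_atD; first exact: value_at1.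
by apply: value_atN; exact: e_off.
Qed.

Lemma compl_neq0 i : 1 - e i != 0.
Proof. by rewrite subr_eq0 eq_sym. Qed.

(** The two nonzero primes at c i; they coincide unless b i holds. *)
Definition place_prime i (s : bool) : set holomorphy_ring :=
  fun x : holomorphy_ring =>
    if s then val_max i (holo_val x) else value_at (c i) (holo_val x) 0.

Lemma place_primeP i s : prime_ideal (place_prime i s).
Proof.
case: s; apply/prime_idealE; rewrite /place_prime; split.
- by rewrite holo_val0; apply: val_max_of_zero; exact: value_at0.
- by rewrite holo_val1; exact: val_max1.
- move=> a x y xm ym; rewrite holo_valD holo_valM; apply: val_maxD => //.
  by apply: val_maxM => //; exact: holo_valP.
- move=> x y; rewrite holo_valM; apply: val_max_prime; exact: holo_valP.
- by rewrite holo_val0; exact: value_at0.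
- by rewrite holo_val1 => /(value_at_uniq (value_at1 _))/eqP; rewrite oner_eq0.
- move=> a x y x0 y0; have [v av _] := holo_valP a i.
  rewrite holo_valD holo_valM -[X in value_at _ _ X](addr0 0).
  apply: value_atD => //; rewrite -[X in value_at _ _ X](mulr0 v).
  exact: value_atM.
- move=> x y; rewrite holo_valM; have [v xv _] := holo_valP x i.
  have [w yw _] := holo_valP y i.
  move=> /(value_at_uniq (value_atM xv yw))/eqP.
  by rewrite mulf_eq0 => /orP[]/eqP v0; [left; rewrite -v0|right; rewrite -v0].
Qed.

Lemma place_prime_le i (s t : bool) :
  (s && b i -> t) -> place_prime i s `<=` place_prime i t.
Proof.
case: s t => [] [] //= st; try exact: subset_refl.
  move=> x; rewrite /place_prime /val_max /residue_max.
  by case: (b i) st => [/(_ isT)//|_ [v xv <-]].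
by move=> x; exact: val_max_of_zero.
Qed.

Lemma place_prime_le_max i s : place_prime i s `<=` place_prime i true.
Proof. exact: place_prime_le. Qed.

Lemma compl_mem i s : place_prime i s (1 - e i).
Proof. by apply: (@place_prime_le i false) => //; exact: compl_diag. Qed.

(** The element e i * y + (1 - e i) of P has at c i the value of y, and at the
    other centres the value 1. So it divides (z * e i) ^+ m as soon as this
    holds at c i, and e i is not in P. *)
Lemma prime_mem_at P i (y z : holomorphy_ring) v w m :
  prime_ideal P -> P (1 - e i) -> P y ->
  value_at (c i) (holo_val y) v -> v != 0 -> value_at (c i) (holo_val z) w ->
  residue_ring i (w ^+ m / v) -> P z.
Proof.
move=> Pp Pi Py yv v0 zw wvO; have Pid := prime_ideal_ideal Pp.
have /prime_idealE[_ P1 _ Pmul] := Pp.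
have nPe : ~ P (e i).
  by move=> Pe; apply: P1; rewrite -[1](subrK (e i)); exact: idealD.
pose g := e i * y + (1 - e i).
have Pg : P g by apply: idealD => //; exact: idealM.
have g_i : value_at (c i) (holo_val g) v.
  rewrite holo_valD holo_valM -[v]addr0 -[v]mul1r.
  by apply: value_atD; [exact: value_atM|exact: compl_diag].
have g_j j : j != i -> value_at (c j) (holo_val g) 1.
  move=> ji; have [a ya _] := holo_valP y j.
  rewrite holo_valD holo_valM.
  rewrite [X in value_at _ _ X](_ : _ = 0 * a + 1); last by rewrite mul0r add0r.
  by apply: value_atD; [apply: value_atM => //; exact: e_off|exact: compl_off].
have g0 : g != 0.
  apply: contra_neq v0 => g0; apply: value_at_uniq g_i _.
  by rewrite g0 holo_val0; exact: value_at0.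
have : principal g ((z * e i) ^+ m).
  apply: holo_dvd => // j; have [->|ji] := eqVneq j i.
    exists (w ^+ m / v) => //; rewrite holo_valX holo_valM.
    apply: value_atM; last exact: value_atV.
    by rewrite -[w]mulr1; apply: value_atX; exact: value_atM.
  apply: val_ringM; first exact: holo_valP.
  by apply: val_ringV_of_one; exact: g_j.
by move=> [a zeE]; have := prime_idealX Pp (x := z * e i) (n := m); rewrite zeE;
  case/(_ (idealM _ Pid Pg))/Pmul.
Qed.

(** A nonzero x in P divides a product of powers of the 1 - e i, so P contains
    one of these. That fixes the centre; P then contains all elements vanishing
    at c i, consists of non-units there, and, as soon as it has an element with
    nonzero value at c i, contains all these non-units, by the archimedean
    property of the residue valuation. *)
Lemma place_prime_complete P : prime_ideal P -> P <> [set 0] ->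
  exists i s, P = place_prime i s.
Proof.
move=> Pp P0; have Pid := prime_ideal_ideal Pp.
have /prime_idealE[Pz P1 _ Pmul] := Pp.
have [x Px x0] : exists2 x : holomorphy_ring, P x & x != 0.
  apply: contrapT => nx; apply: P0; apply/seteqP; split=> [x Px|_ -> //].
  by apply/eqP/negPn/negP => x0; apply: nx; exists x.
have [i Pi] : exists i, P (1 - e i).
  have /choice[m mP] : forall i, exists m,
      value_at (c i) (holo_val (1 - e i) ^+ m * (holo_val x)^-1) 0.
    by move=> i; apply: value_at_archimedean; exact: compl_diag.
  have : P (\prod_i (1 - e i) ^+ m i).
    have [a ->] : principal x (\prod_i (1 - e i) ^+ m i); last exact: idealM.
    apply: holo_dvd => // i; rewrite (bigD1 i) // holo_valM mulrAC holo_valX.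
    apply: val_ringM; last exact: holo_valP.
    by exists 0 => //; exact: residue_ring0.
  move=> Pprod; apply: contrapT => /forallNP nPi; move: Pprod.
  elim/big_ind: _ => // [u v nPu nPv /Pmul[]//|i _ /(prime_idealX Pp)].
  exact: nPi.
have Pmax : P `<=` place_prime i true.
  move=> y Py; have [v yv vO] := holo_valP y i; apply: contrapT => ym.
  have [|v0 vVO] := residue_unit vO; first by move=> vm; apply: ym; exists v.
  apply: P1; apply: (@prime_mem_at P i y 1 v 1 0) => //; last by rewrite mul1r.
  by rewrite holo_val1; exact: value_at1.
have Pmin : place_prime i false `<=` P.
  move=> y y0.
  have [m ym] := value_at_archimedean (holo_val (1 - e i))^-1 y0.
  have nPe : ~ P (e i).
    by move=> Pe; apply: P1; rewrite -[1](subrK (e i)); exact: idealD.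
  have : principal (1 - e i) ((y * e i) ^+ m).
    apply: holo_dvd; first exact: compl_neq0.
    move=> j; rewrite holo_valX holo_valM exprMn mulrAC.
    have [->|ji] := eqVneq j i.
      apply: val_ringM; last by apply: val_ringX; exact: holo_valP.
      by exists 0 => //; exact: residue_ring0.
    apply: val_ringM; last by apply: val_ringX; exact: holo_valP.
    apply: val_ringM; first by apply: val_ringX; exact: holo_valP.
    by apply: val_ringV_of_one; exact: compl_off.
  move=> [a yeE]; have := prime_idealX Pp (x := y * e i) (n := m); rewrite yeE.
  by case/(_ (idealM _ Pid Pi))/Pmul.
exists i; have [Psub|Psub] := pselect (P `<=` place_prime i false).
  by exists false; apply/seteqP.
have [y Py ny] : exists2 y : holomorphy_ring, P y & ~ place_prime i false y.
  apply: contrapT => ny; apply: Psub => y Py; apply: contrapT => y0.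
  by apply: ny; exists y.
exists true; apply/seteqP; split=> // z [w zw wm].
have [v yv vO] := holo_valP y i.
have v0 : v != 0 by apply/eqP => v0; apply: ny; rewrite v0 in yv.
have [m wvO] := residue_archimedean v^-1 wm.
exact: (@prime_mem_at P i y z v w m).
Qed.

Lemma holo_spectrum_shape : spectrum_shape (holomorphy_ring : idomainType) b.
Proof.
exists place_prime; split.
- move=> i s; split; first exact: place_primeP.
  move=> P0; have := compl_mem i s; rewrite P0 => /eqP.
  by apply/negP; exact: compl_neq0.
- exact: place_prime_complete.
move=> i j s t; split=> [sub|[<-]]; last exact: place_prime_le.
have ij : i = j.
  apply/eqP/negPn/negP => ij.
  have [v v1 vm] : val_max j (holo_val (1 - e i)).
    exact/(@place_prime_le_max j t)/sub/compl_mem.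
  apply: (@residue_max1 j).
  by rewrite (value_at_uniq (compl_off _) v1) // eq_sym.
rewrite -{}ij in sub *; split=> // /andP[sT bi]; apply/negPn/negP => /negPf tF.
have X0 : value_at 0 ('X%:F : k) 0.
  by have := value_at_poly (0 : F) 'X; rewrite hornerX.
(* The constant t separates the two primes at a centre with b i. *)
have [|x xE] := @holo_poly ('X%:F)%:P.
  by move=> l _; rewrite hornerC; exists 0.
have xX : value_at (c i) (holo_val x) 'X%:F.
  by rewrite xE; have := value_at_poly (c i) ('X%:F)%:P; rewrite hornerC.
have : place_prime i t x.
  by apply: sub; rewrite sT; exists 'X%:F => //; rewrite /residue_max bi.
rewrite tF => /(value_at_uniq xX)/eqP; rewrite tofrac_eq0; by rewrite polyX_eq0.
Qed.

End Spectrum.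
End PrescribedSpectrum.

(** Centre 0 is avoided, as [interpolation_poly] requires. *)
Lemma prufer_spectrum_shape n (b : 'I_n -> bool) :
  exists R : idomainType, prufer_domain R /\ spectrum_shape R b.
Proof.
pose c (i : 'I_n) : {fraction {poly rat}} := ((i.+1)%:R)%:P%:F.
have c_inj : injective c.
  move=> i j /eqP; rewrite tofrac_eq => /eqP/polyC_inj/eqP.
  by rewrite eqr_nat eqSS => /eqP/val_inj.
have c_neq0 i : c i != 0 by rewrite tofrac_eq0 polyC_eq0 pnatr_eq0.
have /choice[e eP] := holo_separator b c_inj c_neq0.
exists (holomorphy_ring b c : idomainType); split.
  by apply: (@holo_prufer _ _ _ _ e) => i; have [] := eP i.
by apply: (@holo_spectrum_shape _ _ _ _ e) => i; have [] := eP i.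
Qed.

(** * The spectrum of a GMPD domain *)

Theorem mainTheorem10 (D : idomainType) :
  GMPD_domain D -> finite_set (overrings D) ->
  exists R : idomainType, prufer_domain R /\ poset_isomorphic (Spec D) (Spec R).
Proof.
move=> gmpd fin; have [n [b Db]] := GMPD_spectrum_shape gmpd fin.
have [R [Rp Rb]] := prufer_spectrum_shape b.
by exists R; split=> //; exact: spectrum_shape_isomorphic Db Rb.
Qed.
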